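(* Let $G$ be a finitely generated group equipped with a word metric (with respect to a finite generating set), and suppose $G$ has a coarse quasi-action $\{f_g\}_{g\in G}$ on a proper metric space $X$. Let $x_0\in X$ be a chosen base point, and for $R\ge 0$ let $W_R(x_0)=\{g\in G \mid d(f_g(x_0),x_0)\le R\}$ be the $R$-quasi-stabilizer of $x_0$, regarded as a metric subspace of $G$. (a) Suppose there is a number $n\ge 0$ such that $\operatorname{asdim}(W_R(x_0))\le n$ for all $R\ge 0$. If $X$ has finite asymptotic dimension (FAD), then $G$ has FAD. If $X$ has asymptotic property C (APC), then $G$ has APC. (b) If $X$ has finite decomposition complexity (FDC) and $W_R(x_0)$ has FDC for all $R\ge 0$, then $G$ has FDC. If $X$ has straight finite decomposition complexity (sFDC) and $W_R(x_0)$ has sFDC for all $R\ge 0$, then $G$ has sFDC.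
   Context: A metric space is proper if its closed bounded subsets are compact. The word metric on $G$ is the left-invariant one, so that left multiplication acts by isometries. Coarse quasi-action: A map $f\colon X\to Y$ of proper metric spaces is bornologous if there is a real positive non-decreasing function $\ell$ (on $[0,\infty)$) such that $d_X(x_1,x_2)\le r$ implies $d_Y(f(x_1),f(x_2))\le \ell(r)$. A coarse quasi-action of a group $G$ on $X$ is an assignment of a bornologous map $f_g\colon X\to X$ to each $g\in G$ such that: (1) all $f_g$ are bornologous with respect to one common function $\ell$; (2) there is $A\ge 0$ with $d(f_{\mathrm{id}}(x),x)\le A$ for all $x\in X$, where $\mathrm{id}\in G$ is the identity element; (3) there is $B\ge 0$ with $d(f_g(f_h(x)),f_{gh}(x))\le B$ for all $g,h\in G$ and $x\in X$. Disjointness: For a subset $S$ of a metric space $Z$ and $b\ge 0$, let $S[b]=\{z\in Z\mid d(z,s)\le b \text{ for some } s\in S\}$. For $R>0$, a collection of disjoint subsets $S_\alpha$ of $Z$ is $R$-disjoint if $S_\alpha[R]$ is disjoint from $\bigcup_{\beta\ne\alpha}S_\beta$ for every $\alpha$. A family of subsets (or of metric spaces) is (uniformly) bounded if there is a uniform bound on the diameters of its members. FAD: The asymptotic dimension $\operatorname{asdim}(Z)$ is the smallest integer $n\ge 0$ such that for every $R>0$ there are $n+1$ uniformly bounded $R$-disjoint families of subsets of $Z$ which together cover $Z$. $Z$ has FAD if such $n$ exists. APC: $Z$ has APC if for every sequence $0<R_1\le R_2\le\cdots$ there exist a natural number $n$ and uniformly bounded families $\mathcal{W}_i$ of subsets of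 $Z$, $1\le i\le n$, with $\mathcal{W}_i$ being $R_i$-disjoint, whose union covers $Z$. Decomposition: For families $\mathcal{X},\mathcal{Y}$ of metric spaces and $R>0$, $\mathcal{X}$ is $R$-decomposable over $\mathcal{Y}$ if for every $X'\in\mathcal{X}$ there are two $R$-disjoint collections $\{U_{1,\alpha}\}_{\alpha}$, $\{U_{2,\beta}\}_{\beta}$ of subsets of $X'$, all of whose members belong to $\mathcal{Y}$, and which together cover $X'$. FDC: Consider the following game over $Z$, in which all families consist of metric subspaces of $Z$. Put $\mathcal{Y}_0=\{Z\}$. In round $i\ge 1$ the first player selects $R_i>0$, and then the second player selects a family $\mathcal{Y}_i$ and an $R_i$-decomposition of $\mathcal{Y}_{i-1}$ over $\mathcal{Y}_i$. The second player wins if $\mathcal{Y}_k$ is bounded for some finite $k$. $Z$ has FDC if the second player possesses a winning strategy. sFDC: $Z$ has sFDC if for every sequence $R_1\le R_2\le\cdots$ of positive numbers there is a finite sequence of families of metric spaces $\mathcal{V}_1,\dots,\mathcal{V}_n$ such that $\{Z\}$ is $R_1$-decomposable over $\mathcal{V}_1$, $\mathcal{V}_{i-1}$ is $R_i$-decomposable over $\mathcal{V}_i$ for $2\le i\le n$, and $\mathcal{V}_n$ is bounded. *)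

(* Defs.v *)
From HB Require Import structures.
From mathcomp Require Import all_boot all_order all_algebra.
From mathcomp Require Import all_classical all_reals all_analysis.

Set Implicit Arguments.
Unset Strict Implicit.
Unset Printing Implicit Defensive.
Import Order.TTheory GRing.Theory Num.Theory.
Local Open Scope classical_set_scope.
Local Open Scope ring_scope.

(* A metric (sub)space is a subset Z of an ambient metricType T with the
   restricted distance, so a family of subspaces has type set (set T).        *)

Section Families.
Context {R : realType} {T : metricType R}.
Implicit Types (A B Z : set T) (C F : set (set T)).

(* Every member of F has diameter at most D. *)
Definition uniformly_bounded F :=
  exists D : R, forall A, F A -> forall x y, A x -> A y -> mdist x y <= D.

Definition proper_metric_space :=
  forall A, closed A -> uniformly_bounded [set A] -> compact A.

Definition thickening A (b : R) : set T :=
  [set z | exists2 s, A s & mdist z s <= b].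

Definition R_disjoint (r : R) C :=
  trivIset C id /\
  forall A, C A -> thickening A r `&` \bigcup_(B in C `\ A) B = set0.

Definition subspaces Z : set (set T) := [set A | A `<=` Z].

End Families.

Arguments proper_metric_space {R} T.

Section DimensionProperties.
Context {R : realType} {T : metricType R}.
Implicit Types (A Z : set T) (XX YY : set (set T)).

Definition asdim_covers Z (n : nat) :=
  forall r : R, 0 < r -> exists F : 'I_n.+1 -> set (set T),
    (forall i, [/\ F i `<=` subspaces Z, uniformly_bounded (F i)
                 & R_disjoint r (F i)]) /\
    Z `<=` \bigcup_i \bigcup_(A in F i) A.

Definition is_asdim Z (n : nat) :=
  asdim_covers Z n /\ forall m, asdim_covers Z m -> (n <= m)%N.

Definition asdim_le Z (n : nat) := exists2 m, is_asdim Z m & (m <= n)%N.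

Definition FAD Z := exists n, is_asdim Z n.

(* Here and below the sequence R_1, R_2, ... is r 0, r 1, ... *)
Definition APC Z :=
  forall r : nat -> R, (forall i, 0 < r i) ->
    (forall i j, (i <= j)%N -> r i <= r j) ->
  exists (n : nat) (W : 'I_n -> set (set T)),
    (forall i, [/\ W i `<=` subspaces Z, uniformly_bounded (W i)
                 & R_disjoint (r i) (W i)]) /\
    Z `<=` \bigcup_i \bigcup_(A in W i) A.

Definition decomposes (r : R) A (U : set (set T) * set (set T)) YY :=
  [/\ U.1 `<=` subspaces A /\ U.2 `<=` subspaces A,
      R_disjoint r U.1 /\ R_disjoint r U.2,
      U.1 `<=` YY /\ U.2 `<=` YY
    & A `<=` \bigcup_(B in U.1 `|` U.2) B].

Definition decomposable (r : R) XX YY :=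
  forall A, XX A -> exists U, decomposes r A U YY.

(* A move of the second player: a family, and for each member of the previous
   family the two collections into which it is decomposed. *)
Record move := Move {
  move_family : set (set T);
  move_pieces : set T -> set (set T) * set (set T)
}.

(* A strategy answers the nonempty list of all choices R_1, ..., R_i made so
   far by the first player; the second player's own earlier moves are
   determined by the prefixes of that list. *)
Definition strategy := seq R -> move.

Definition game_family Z (s : strategy) (r : nat -> R) (k : nat) :
    set (set T) :=
  if k is 0%N then [set Z] else move_family (s (mkseq r k)).

Definition legal_move Z (r : R) XX (m : move) :=
  move_family m `<=` subspaces Z /\
  forall A, XX A -> decomposes r A (move_pieces m A) (move_family m).

Definition winning_strategy Z (s : strategy) :=
  forall r : nat -> R, (forall i, 0 < r i) ->
    (forall k, legal_move Z (r k) (game_family Z s r k) (s (mkseq r k.+1))) /\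
    exists k, uniformly_bounded (game_family Z s r k).

Definition FDC Z := exists s, winning_strategy Z s.

Definition sFDC Z :=
  forall r : nat -> R, (forall i, 0 < r i) ->
    (forall i j, (i <= j)%N -> r i <= r j) ->
  exists (n : nat) (V : nat -> set (set T)),
    [/\ (0 < n)%N, V 0%N = [set Z],
        forall i, (i < n)%N -> decomposable (r i) (V i) (V i.+1)
      & uniformly_bounded (V n)].

End DimensionProperties.

Section WordMetric.
Context {G : groupType}.
Implicit Types (S : set G) (g h : G) (w : seq G).

Definition is_word S w := forall s, s \in w -> S s \/ S (s^-1)%g.

Definition expressible S g (n : nat) :=
  exists w, [/\ is_word S w, size w = n & (\prod_(s <- w) s)%g = g].

Definition generates S := forall g, exists n, expressible S g n.

Lemma generates_asbool S (genS : generates S) g :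
  exists n, `[< expressible S g n >].
Proof. by have [n gn] := genS g; exists n; apply/asboolP. Qed.

Definition word_length S (genS : generates S) g : nat :=
  ex_minn (generates_asbool genS g).

Lemma word_lengthP S (genS : generates S) g :
  expressible S g (word_length genS g).
Proof. by rewrite /word_length; case: ex_minnP => n /asboolP. Qed.

Lemma word_length_min S (genS : generates S) g n :
  expressible S g n -> (word_length genS g <= n)%N.
Proof.
by rewrite /word_length; case: ex_minnP => m _ mmin gn; apply/mmin/asboolP.
Qed.

Lemma word_length1 S (genS : generates S) : word_length genS 1%g = 0%N.
Proof.
apply/eqP; rewrite -leqn0; apply: word_length_min.
by exists [::]; split => //; rewrite big_nil.
Qed.

Lemma word_length_eq0 S (genS : generates S) g :
  word_length genS g = 0%N -> g = 1%g.
Proof.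
move=> g0; have [w [_ sw <-]] := word_lengthP genS g.
by move: sw; rewrite g0 => /size0nil ->; rewrite big_nil.
Qed.

Lemma word_lengthV_le S (genS : generates S) g :
  (word_length genS (g^-1)%g <= word_length genS g)%N.
Proof.
have [w [Sw sw wg]] := word_lengthP genS g.
apply: word_length_min; exists (rev [seq (s^-1)%g | s <- w]); split.
- move=> s; rewrite mem_rev => /mapP[t /Sw St ->].
  by rewrite invgK; case: St; [right|left].
- by rewrite size_rev size_map.
- by rewrite -wg -{2}(revK w) -prodgV -map_rev big_map.
Qed.

Lemma word_lengthV S (genS : generates S) g :
  word_length genS (g^-1)%g = word_length genS g.
Proof.
apply/eqP; rewrite eqn_leq word_lengthV_le /=.
by rewrite -{1}(invgK g) word_lengthV_le.
Qed.

Lemma word_lengthM S (genS : generates S) g h :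
  (word_length genS (g * h)%g <= word_length genS g + word_length genS h)%N.
Proof.
have [v [Sv sv vg]] := word_lengthP genS g.
have [w [Sw sw wh]] := word_lengthP genS h.
apply: word_length_min; exists (v ++ w); split.
- by move=> s; rewrite mem_cat => /orP[/Sv|/Sw].
- by rewrite size_cat sv sw.
- by rewrite big_cat /= vg wh.
Qed.

(* The carrier of G, equipped with the word metric of S. *)
Definition word_metric (R : realType) S (genS : generates S) : Type := G.

Variables (R : realType) (S : set G) (genS : generates S).
Local Notation T := (word_metric R genS).

Definition word_dist (g h : T) : R :=
  (word_length genS ((g : G)^-1 * (h : G))%g)%:R.

Lemma word_distxx g : word_dist g g = 0.
Proof. by rewrite /word_dist mulVg word_length1. Qed.

Lemma word_dist_positivity g h : word_dist g h = 0 -> g = h.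
Proof.
rewrite /word_dist => /eqP; rewrite pnatr_eq0 => /eqP /word_length_eq0 gh.
by rewrite -[RHS](mulVKg g) gh mulg1.
Qed.

Lemma word_dist_sym g h : word_dist g h = word_dist h g.
Proof. by rewrite /word_dist -word_lengthV invgM invgK. Qed.

Lemma word_dist_triangle h g k : word_dist g k <= word_dist g h + word_dist h k.
Proof.
rewrite /word_dist -natrD ler_nat.
have -> : (g^-1 * k = (g^-1 * h) * (h^-1 * k))%g by rewrite -mulgA mulVKg.
exact: word_lengthM.
Qed.

HB.instance Definition _ := Choice.on T.
HB.instance Definition _ := @isMetric.Build R T
  word_dist word_distxx word_dist_positivity word_dist_sym word_dist_triangle.

Lemma mdist_word (g h : T) : mdist g h = word_dist g h.
Proof. by []. Qed.

End WordMetric.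

Section CoarseQuasiAction.
Context {R : realType} {G : groupType} {X : metricType R}.

Definition control_function (ell : R -> R) :=
  (forall r, 0 <= r -> 0 < ell r) /\
  (forall r s, 0 <= r -> r <= s -> ell r <= ell s).

Definition bornologous_by (ell : R -> R) (f : X -> X) :=
  forall r, 0 <= r -> forall x1 x2,
    mdist x1 x2 <= r -> mdist (f x1) (f x2) <= ell r.

Definition coarse_quasi_action (f : G -> X -> X) :=
  [/\ exists ell, control_function ell /\ forall g, bornologous_by ell (f g),
      exists2 A : R, 0 <= A & forall x, mdist (f 1%g x) x <= A
    & exists2 B : R, 0 <= B &
        forall g h x, mdist (f g (f h x)) (f (g * h)%g x) <= B].

Definition quasi_stabilizer (f : G -> X -> X) (x0 : X) (r : R) : set G :=
  [set g | mdist (f g x0) x0 <= r].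

End CoarseQuasiAction.

(* Main.v *)
Require Import Defs.
From HB Require Import structures.
From mathcomp Require Import all_boot all_order all_algebra.
From mathcomp Require Import all_classical all_reals all_analysis.

Set Implicit Arguments.
Unset Strict Implicit.
Unset Printing Implicit Defensive.
Import Order.TTheory GRing.Theory Num.Theory.
Local Open Scope classical_set_scope.
Local Open Scope ring_scope.

(* The orbit map g |-> f_g(x0) is Lipschitz: by the quasi-action axioms, right
   multiplication by a generator moves it by a bounded amount. If f_g(x0) and
   f_g0(x0) are at distance at most D, then g0^-1 g lies in W_r(x0) with r
   depending only on D, so the preimage of a D-bounded set lies in a translate
   of W_r(x0). Decompositions and covers of X therefore pull back to G, down to
   pieces which are then decomposed or covered as subspaces of a single
   quasi-stabilizer; for covers this multiplies the number of families by
   n + 1. *)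

(** * Separated collections and one-step decompositions *)

Section Disjointness.
Context {R : realType} {T : metricType R}.
Implicit Types (A B Z : set T) (C F XX YY : set (set T)).

(** Taking [x = y], possible since [0 <= r], recovers pairwise disjointness, so one condition
    replaces both clauses of [R_disjoint]. *)
Lemma R_disjointP (r : R) C : 0 <= r ->
  R_disjoint r C <->
  forall A B x y, C A -> C B -> A x -> B y -> mdist x y <= r -> A = B.
Proof.
move=> r0; split=> [[_ dC] A B x y CA CB Ax By xy|dC].
  apply: contrapT => AB.
  have /seteqP[/(_ y) yC _] := dC _ CA; apply: yC; split.
    by exists x => //; rewrite metric_sym.
  by exists B => //; split=> // BA; apply: AB.
split=> [A B CA CB [x [Ax Bx]]|A CA].
  by apply: (dC A B x x) => //; rewrite mdistxx.
apply/seteqP; split=> // y [[x Ax yx] [B [CB BA] By]].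
by apply: BA => /=; apply/esym/(dC A B x y) => //; rewrite metric_sym.
Qed.

Lemma R_disjoint_sing (r : R) A : 0 <= r -> R_disjoint r [set A].
Proof. by move=> r0; apply/R_disjointP => // ? ? ? ? -> ->. Qed.

Lemma R_disjoint0 (r : R) : 0 <= r -> R_disjoint r (set0 : set (set T)).
Proof. by move=> r0; apply/R_disjointP. Qed.

Lemma uniformly_bounded_sub F F' :
  F' `<=` F -> uniformly_bounded F -> uniformly_bounded F'.
Proof. by move=> FF' [D DF]; exists D => A /FF'; exact: DF. Qed.

Lemma decomposable_subl (r : R) XX XX' YY :
  XX' `<=` XX -> decomposable r XX YY -> decomposable r XX' YY.
Proof. by move=> sXX dXX A /sXX; exact: dXX. Qed.

(** The idle move of the second player, repeated once the family is bounded. *)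
Lemma decomposes_self (r : R) A YY :
  0 <= r -> YY A -> decomposes r A ([set A], set0) YY.
Proof.
move=> r0 YA; split=> /=.
- by split=> [_ ->|//] //.
- by split; [exact: R_disjoint_sing|exact: R_disjoint0].
- by split=> [_ ->|].
- by move=> x Ax; exists A => //; left.
Qed.

End Disjointness.

(** * Pulling back decompositions along Lipschitz maps *)

Section Preimages.
Context {R : realType} {T T' : metricType R}.
Implicit Types (A : set T) (B : set T') (XX YY : set (set T')).

Definition lipschitz_by (L : R) (phi : T -> T') :=
  forall x y, mdist (phi x) (phi y) <= L * mdist x y.

(** Closure under subsets lets pieces be cut down to the set being decomposed; a set of maps is
    allowed because each fibre comes with its own translation. *)
Definition preimages (Phi : set (T -> T')) YY : set (set T) :=
  [set A | exists2 phi, Phi phi & exists2 B, YY B & A `<=` phi @^-1` B].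

Lemma R_disjoint_preimage (L r : R) (phi : T -> T') A YY :
  0 < L -> 0 <= r -> lipschitz_by L phi -> R_disjoint (L * r) YY ->
  R_disjoint r [set A `&` phi @^-1` B | B in YY].
Proof.
move=> L0 r0 Lphi /R_disjointP dYY; apply/R_disjointP => //.
move=> _ _ x y [B YB <-] [B' YB' <-] [_ Bx] [_ By] xy.
rewrite (dYY _ B B' (phi x) (phi y)) ?mulr_ge0 ?(ltW L0)//.
by rewrite (le_trans (Lphi x y))// ler_pM2l.
Qed.

Lemma decomposable_preimages (Phi : set (T -> T')) (L r : R) XX YY :
  0 < L -> 0 <= r -> (forall phi, Phi phi -> lipschitz_by L phi) ->
  decomposable (L * r) XX YY ->
  decomposable r (preimages Phi XX) (preimages Phi YY).
Proof.
move=> L0 r0 LPhi dXX A [phi Pphi [B /dXX[[U1 U2] /=]]].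
move=> [/= _ [dU1 dU2] [sU1 sU2] Bcov] AB.
exists ([set A `&` phi @^-1` C | C in U1], [set A `&` phi @^-1` C | C in U2]).
have Lphi := LPhi _ Pphi.
split=> /=.
- by split=> _ [C _ <-] x [].
- by split; apply: R_disjoint_preimage Lphi _.
- by split=> _ [C UC <-]; exists phi => //; exists C;
    [exact: sU1|move=> x []|exact: sU2|move=> x []].
- move=> x Ax; have [C UC Cx] := Bcov _ (AB _ Ax).
  exists (A `&` phi @^-1` C) => //.
  by case: UC => UC; [left|right]; exists C.
Qed.

Lemma uniformly_bounded_preimages (Phi : set (T -> T')) YY :
  (forall phi, Phi phi -> forall x y, mdist (phi x) (phi y) = mdist x y) ->
  uniformly_bounded YY -> uniformly_bounded (preimages Phi YY).
Proof.
move=> iPhi [D DY]; exists D => A [phi Pphi [B YB AB]] x y /AB Bx /AB By.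
by rewrite -(iPhi _ Pphi); exact: DY YB _ _ Bx By.
Qed.

End Preimages.

(** * Games *)

Section Games.
Context {R : realType} {T : metricType R}.
Implicit Types (Z : set T) (F XX YY : set (set T)) (s : @strategy R T).

(* The Guentner-Tessera-Yu description of the game: FDC is membership of the
   one-element family [set Z] in this class, which allows proofs by induction
   instead of composing strategies. *)
Inductive FDC_class : set (set T) -> Prop :=
| FDC_class_bounded F : uniformly_bounded F -> FDC_class F
| FDC_class_step F (YY : R -> set (set T)) :
    (forall r, 0 < r -> decomposable r F (YY r)) ->
    (forall r, 0 < r -> FDC_class (YY r)) -> FDC_class F.

Lemma FDC_class_sub F F' : F' `<=` F -> FDC_class F -> FDC_class F'.
Proof.
move=> sF cF; case: cF sF => {}F => [bF|YY dF cYY] sF.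
  by apply: FDC_class_bounded; exact: uniformly_bounded_sub bF.
apply: (FDC_class_step (YY := YY)) => // r r0.
by apply: decomposable_subl sF _; exact: dF.
Qed.

(* Whenever the current family is outside FDC_class, some choice of the first
   player keeps the answer of the strategy outside, so it never gets bounded. *)
Lemma FDC_FDC_class Z : FDC Z -> FDC_class [set Z].
Proof.
move=> [s win]; apply: contrapT => nZ.
pose fam l := if l is [::] then [set Z] else move_family (s l).
have famE (r : nat -> R) k : game_family Z s r k = fam (mkseq r k) by case: k.
have next (l : seq R) : exists r, (forall x, x \in l -> 0 < x) ->
    ~ FDC_class (fam l) -> 0 < r /\ ~ FDC_class (fam (rcons l r)).
  apply: contrapT => /forallNP nl.
  have posl x : x \in l -> 0 < x.
    by have /not_implyP[+ _] := nl 0; exact.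
  have ncl : ~ FDC_class (fam l).
    by have /not_implyP[_ /not_implyP[+ _]] := nl 0.
  apply: ncl.
  apply: (FDC_class_step (YY := fun r => fam (rcons l r))) => r r0; last first.
    by apply: contrapT => nc; apply: (nl r).
  (* [winning_strategy] speaks of infinite plays, so the finite list is continued by the positive
     default 1. *)
  pose q i := nth 1 (rcons l r) i.
  have q0 i : 0 < q i.
    rewrite /q; have [il|il] := ltnP i (size (rcons l r)).
      by have := mem_nth 1 il; rewrite mem_rcons inE => /orP[/eqP->|/posl].
    by rewrite nth_default.
  have [/(_ (size l)) [_ leg] _] := win q q0.
  have ql : mkseq q (size l) = l.
    rewrite -[RHS](mkseq_nth 1); apply/eq_in_map => i.
    by rewrite mem_iota /= => il; rewrite /q nth_rcons il.
  have qSl : mkseq q (size l).+1 = rcons l r.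
    by rewrite -[RHS](mkseq_nth 1) size_rcons.
  have qr : q (size l) = r by rewrite /q nth_rcons ltnn eqxx.
  move=> A; rewrite famE ql qr qSl in leg => lA.
  exists (move_pieces (s (rcons l r)) A); have := leg _ lA.
  by case: (l).
have [nx nxP] := choice next.
pose play := fix play n := if n is n'.+1 then rcons (play n') (nx (play n'))
  else [::].
pose r n := nx (play n).
have playE n : play n = mkseq r n by elim: n => //= n IH; rewrite mkseqS -IH.
have out n : (forall x, x \in play n -> 0 < x) /\ ~ FDC_class (fam (play n)).
  elim: n => [//|n [posn nn]]; have [r0 nS] := nxP _ posn nn; split=> //= x.
  by rewrite mem_rcons inE => /orP[/eqP->|/posn].
have r0 i : 0 < r i by have [? ?] := out i; have [] := nxP (play i).
have [_ [k bk]] := win r r0.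
have [_] := out k; apply; apply: FDC_class_bounded.
by rewrite playE -famE.
Qed.

(** After one round the position is a whole family, so the induction needs games that start
    anywhere. *)
Definition family_game XX s (r : nat -> R) (k : nat) : set (set T) :=
  if k is 0%N then XX else move_family (s (mkseq r k)).

Definition family_winning XX s :=
  forall r : nat -> R, (forall i, 0 < r i) ->
    (forall k A, family_game XX s r k A ->
       decomposes (r k) A (move_pieces (s (mkseq r k.+1)) A)
         (move_family (s (mkseq r k.+1)))) /\
    exists k, uniformly_bounded (family_game XX s r k).

Lemma mkseq_cons (U : Type) (r : nat -> U) k :
  mkseq r k.+1 = r 0%N :: mkseq (r \o succn) k.
Proof. by rewrite /mkseq /= (iotaDl 1 0) -map_comp. Qed.

Lemma FDC_class_winning XX : FDC_class XX -> exists s, family_winning XX s.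
Proof.
elim=> {XX} [XX bXX|XX YY dXX _ IH].
  exists (fun=> Move XX (fun A => ([set A], set0))) => r r0; split; last first.
    by exists 0%N.
  move=> k A XA; apply: decomposes_self; first exact: ltW.
  by case: k XA.
have /choice[s sP] : forall r, exists t, 0 < r -> family_winning (YY r) t.
  move=> r; have [/IH[s sP]|r0] := boolP (0 < r); first by exists s.
  by exists (fun=> Move set0 (fun=> (set0, set0))).
have /choice[U UP] : forall rA : R * set T, exists V, 0 < rA.1 -> XX rA.2 ->
    decomposes rA.1 rA.2 V (YY rA.1).
  move=> -[r A] /=; have [r0|r0] := boolP (0 < r); last first.
    by exists (set0, set0).
  have [XA|] := pselect (XX A); last by exists (set0, set0).
  by have [V] := dXX r r0 A XA; exists V.
(* The first choice [r] selects [YY r] and the inductive strategy [s r], which then sees only the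
   later choices. The empty list is never queried. *)
pose t (l : seq R) := match l with
  | [::] => Move set0 (fun=> (set0, set0))
  | [:: r] => Move (YY r) (fun A => U (r, A))
  | r :: l' => s r l'
  end.
exists t => r r0.
have tE k : t (mkseq r k.+2) = s (r 0%N) (mkseq (r \o succn) k.+1).
  by rewrite mkseq_cons [in LHS]mkseq_cons /= -mkseq_cons.
have gE k : family_game XX t r k.+1
    = family_game (YY (r 0%N)) (s (r 0%N)) (r \o succn) k.
  by case: k => [//|k]; rewrite /family_game tE.
have [win [k bk]] := sP _ (r0 0%N) (r \o succn) (fun i => r0 i.+1).
split; last by exists k.+1; rewrite gE.
case=> [|j] A; first by move=> XA; exact: (UP (r 0%N, A) (r0 0%N) XA).
by rewrite gE tE; exact: win.
Qed.

Lemma FDC_classP : FDC_class [set [set: T]] -> FDC [set: T].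
Proof.
move=> /FDC_class_winning[s sP]; exists s => r r0.
have gE k : game_family [set: T] s r k = family_game [set [set: T]] s r k.
  by case: k.
have [win [k bk]] := sP r r0.
split; last by exists k; rewrite gE.
by move=> j; split=> [?|A]; [|rewrite gE; exact: win].
Qed.

End Games.

(** Scale [r] upstairs is answered by the family for scale [L * r] downstairs. The bounded case is a
    hypothesis because preimages of bounded sets may be unbounded. *)
Lemma FDC_class_preimages (R : realType) (T T' : metricType R)
    (Phi : set (T -> T')) (L : R) (YY : set (set T')) :
  0 < L -> (forall phi, Phi phi -> lipschitz_by L phi) ->
  (forall F, uniformly_bounded F -> FDC_class (preimages Phi F)) ->
  FDC_class YY -> FDC_class (preimages Phi YY).
Proof.
move=> L0 LPhi bPhi; elim=> {YY} [YY /bPhi//|YY F dF _ IH].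
apply: (FDC_class_step (YY := fun r => preimages Phi (F (L * r)))) => r r0.
  by apply: decomposable_preimages (dF _ _) => //; [exact: ltW|exact: mulr_gt0].
by apply: IH; exact: mulr_gt0.
Qed.

(** * Covers by families at prescribed scales *)

Section Covers.
Context {R : realType} {T : metricType R}.
Implicit Types Z : set T.

(** Common form of both dimension properties: constant [r] for [asdim_covers], non-decreasing [r]
    for [APC]. *)
Definition scale_covers Z (r : nat -> R) (n : nat) :=
  exists F : 'I_n -> set (set T),
    (forall i, [/\ F i `<=` subspaces Z, uniformly_bounded (F i)
                 & R_disjoint (r i) (F i)]) /\
    Z `<=` \bigcup_i \bigcup_(A in F i) A.

Lemma asdim_covers_le Z m n :
  (m <= n)%N -> asdim_covers Z m -> asdim_covers Z n.
Proof.
move=> mn cZ r r0; have [F [FP cF]] := cZ r r0.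
(* Surplus indices repeat [F] at 0, the default of [inord]. *)
exists (fun i => F (inord i)); split=> [i|x /cF[i _ Fx]]; first exact: FP.
exists (widen_ord (mn : (m.+1 <= n.+1)%N) i) => //=.
by rewrite inord_val.
Qed.

Lemma asdim_covers_FAD Z n :
  asdim_covers Z n -> FAD Z.
Proof.
move=> cZ.
have ex : exists n, `[< asdim_covers Z n >] by exists n; apply/asboolP.
exists (ex_minn ex); case: ex_minnP => m /asboolP cm mmin; split=> // k ck.
exact/mmin/asboolP.
Qed.

End Covers.

(** * Fibering *)

Section Fibering.
Context {R : realType} {T T' : metricType R}.
Variables (L : R) (pi : T -> T') (W : R -> set T).
Hypotheses (L_gt0 : 0 < L) (pi_lip : lipschitz_by L pi).

Definition isometric_maps : set (T -> T) :=
  [set tau | forall x y, mdist (tau x) (tau y) = mdist x y].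

(** For the orbit map, [tau] is a left translation and [W r] a quasi-stabilizer. The radius depends
    on [D] alone, so one [W r] serves a whole bounded family. *)
Hypothesis fibres : forall D : R, exists2 r, 0 <= r &
  forall A : set T', (forall x y, A x -> A y -> mdist x y <= D) ->
  exists2 tau, isometric_maps tau & pi @^-1` A `<=` tau @^-1` W r.

Let isometric_lip tau : isometric_maps tau -> lipschitz_by 1 tau.
Proof. by move=> itau x y; rewrite mul1r itau. Qed.

Lemma preimages_bounded_fibre (F : set (set T')) : uniformly_bounded F ->
  exists2 r, 0 <= r &
    preimages [set pi] F `<=` preimages isometric_maps [set W r].
Proof.
move=> [D DF]; have [r r0 rP] := fibres D; exists r => // A [_ -> [B FB AB]].
have [tau itau pitau] := rP B (DF B FB).
by exists tau => //; exists (W r) => // x /AB/pitau.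
Qed.

Lemma FDC_fibering : FDC [set: T'] -> (forall r, 0 <= r -> FDC (W r)) ->
  FDC [set: T].
Proof.
move=> /FDC_FDC_class fT' fW; apply: FDC_classP.
apply: (@FDC_class_sub _ _ (preimages [set pi] [set [set: T']])).
  by move=> _ ->; exists pi => //; exists setT.
(* Pull back along [pi] until the family downstairs is bounded, then continue inside a single [W r]
   along isometries. *)
apply: FDC_class_preimages (L_gt0) _ _ fT' => [_ -> //|F bF].
have [r r0 sF] := preimages_bounded_fibre bF.
apply: FDC_class_sub sF _.
apply: FDC_class_preimages (ltr01) isometric_lip _ (FDC_FDC_class (fW r r0)).
move=> F' bF'; apply: FDC_class_bounded.
by apply: uniformly_bounded_preimages bF' => tau.
Qed.

Lemma sFDC_fibering : sFDC [set: T'] -> (forall r, 0 <= r -> sFDC (W r)) ->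
  sFDC [set: T].
Proof.
move=> fT' fW r r0 rmon.
have [||n [V [n0 V0 Vdec Vb]]] := fT' (fun i => L * r i).
- by move=> i; exact: mulr_gt0.
- by move=> i j ij; rewrite ler_pM2l// rmon.
have [b b0 sV] := preimages_bounded_fibre Vb.
(* The second stage uses the scales left after the first [n] rounds. *)
have [||m [U [m0 U0 Udec Ub]]] := fW b b0 (fun i => r (n + i)%N).
- by move=> i.
- by move=> i j ij; rewrite rmon// leq_add2l.
pose V' i := if i is 0%N then [set [set: T]] else
  if (i <= n)%N then preimages [set pi] (V i)
  else preimages isometric_maps (U (i - n)%N).
(* The two stages meet at index [n], where both this inclusion and the next one hold. *)
have V'l i : (i <= n)%N -> V' i `<=` preimages [set pi] (V i).
  case: i => [_|i ni] /=; last by rewrite ni.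
  by move=> _ ->; rewrite V0; exists pi => //; exists setT.
have V'r i : (n <= i)%N -> V' i `<=` preimages isometric_maps (U (i - n)%N).
  rewrite leq_eqVlt => /predU1P[<-|ni].
    rewrite subnn U0; apply: subset_trans sV; exact: V'l.
  by case: i ni => // i ni /=; rewrite leqNgt ni.
exists (n + m)%N, V'; split => //.
- by rewrite addn_gt0 n0.
- move=> i inm; have [ni|ni] := ltnP i n.
    apply: decomposable_subl (V'l _ (ltnW ni)) _.
    rewrite /= ni; apply: decomposable_preimages L_gt0 _ _ (Vdec _ ni) => //.
      exact: ltW.
    by move=> _ ->.
  apply: decomposable_subl (V'r _ ni) _.
  rewrite /= ltnNge ni /= subSn//.
  apply: decomposable_preimages ltr01 _ isometric_lip _; first exact: ltW.
  by rewrite mul1r -{1}(subnKC ni); apply: Udec; rewrite ltn_subLR.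
- apply: uniformly_bounded_sub (V'r _ (leq_addr _ _)) _.
  by rewrite addKn; apply: uniformly_bounded_preimages Ub => tau.
Qed.

Section Fixed_dimension.
Variable n : nat.
Hypothesis dimW : forall r, 0 <= r -> asdim_covers (W r) n.

(* Each fibre is covered by pulling back one and the same cover of some W b,
   which keeps the bound uniform. *)
Lemma preimage_family_covers (r : R) (F : set (set T')) :
  0 < r -> uniformly_bounded F -> R_disjoint (L * r) F ->
  exists H : 'I_n.+1 -> set (set T),
    (forall j, uniformly_bounded (H j) /\ R_disjoint r (H j)) /\
    pi @^-1` (\bigcup_(A in F) A) `<=` \bigcup_j \bigcup_(A in H j) A.
Proof.
move=> r0 [D DF] dF; have [b b0 bP] := fibres D.
have [K [KP cK]] := dimW b0 r0.
have /choice[tau tauP] : forall A, exists t, F A ->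
    isometric_maps t /\ pi @^-1` A `<=` t @^-1` W b.
  move=> A; have [FA|nFA] := pselect (F A); last by exists id.
  by have [t it pt] := bP A (DF A FA); exists t.
exists (fun j => [set C | exists A B, [/\ F A, K j B &
  C = pi @^-1` A `&` tau A @^-1` B]]); split=> [j|x [A FA Ax]]; last first.
  have [itau /(_ _ Ax) /cK[j _ [B KB Bx]]] := tauP A FA.
  by exists j => //; exists (pi @^-1` A `&` tau A @^-1` B) => //; exists A, B.
have [_ [E KE] dK] := KP j; split.
  exists E => _ [A [B [FA KB ->]]] x y [_ Bx] [_ By].
  by have [itau _] := tauP A FA; rewrite -itau; exact: KE KB _ _ Bx By.
have r0' := ltW r0; have Lr0 : 0 <= L * r by rewrite mulr_ge0// ltW.
apply/R_disjointP => // _ _ x y [A [B [FA KB ->]]] [A' [B' [FA' KB' ->]]].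
move=> [Ax Bx] [A'y B'y] xy.
(* Nearby points lie over the same base piece by disjointness of [F] at scale [L * r]. Both are then
   moved by the same isometry, so disjointness of [K j] applies. *)
have AA' : A = A'.
  apply: ((R_disjointP _ Lr0).1 dF _ _ (pi x) (pi y)) => //.
  by rewrite (le_trans (pi_lip _ _))// ler_pM2l.
rewrite -AA' in B'y *; have [itau _] := tauP A FA.
suff -> : B = B' by [].
by apply: ((R_disjointP _ r0').1 dK _ _ (tau A x) (tau A y)); rewrite ?itau.
Qed.

(** Base family [i] yields [n.+1] families, filling the indices from [i * n.+1] to [i * n.+1 + n].
    Separation at the last, largest scale of this block serves all of them. *)
Lemma scale_covers_fibering (r : nat -> R) m : (forall i, 0 < r i) ->
  (forall i j, (i <= j)%N -> r i <= r j) ->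
  scale_covers [set: T'] (fun i => L * r (i * n.+1 + n)%N) m ->
  scale_covers [set: T] r (m * n.+1).
Proof.
move=> r0 rmon [F [FP cF]].
have /choice[H HP] (i : 'I_m) : exists K : 'I_n.+1 -> set (set T),
    (forall j, uniformly_bounded (K j) /\
               R_disjoint (r (i * n.+1 + n)%N) (K j)) /\
    pi @^-1` (\bigcup_(A in F i) A) `<=` \bigcup_j \bigcup_(A in K j) A.
  by have [_ bF dF] := FP i; exact: preimage_family_covers.
have divm (k : 'I_(m * n.+1)) : (k %/ n.+1 < m)%N by rewrite ltn_divLR.
have modn (k : 'I_(m * n.+1)) : (k %% n.+1 < n.+1)%N by rewrite ltn_pmod.
exists (fun k => H (Ordinal (divm k)) (Ordinal (modn k))); split=> [k|x _].
  have [/(_ (Ordinal (modn k)))[bH dH] _] := HP (Ordinal (divm k)).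
  split=> //.
  have rk : r k <= r (k %/ n.+1 * n.+1 + n)%N.
    by apply: rmon; rewrite {1}(divn_eq k n.+1) leq_add2l -ltnS ltn_pmod.
  apply/R_disjointP => [|A B y z HA HB Ay Bz yz]; first exact: ltW.
  apply: ((R_disjointP _ (ltW (r0 _))).1 dH _ _ y z) => //.
  exact: le_trans yz rk.
have [i _ Fx] := cF (pi x) I.
have [_ /(_ _ Fx)[j _ Hx]] := HP i.
have ijP : (i * n.+1 + j < m * n.+1)%N.
  apply: (@leq_trans (i.+1 * n.+1)); last by rewrite leq_mul2r ltn_ord orbT.
  by rewrite mulSn addnC ltn_add2r.
exists (Ordinal ijP) => //.
have -> : Ordinal (divm (Ordinal ijP)) = i.
  by apply: val_inj; rewrite /= divnMDl// divn_small ?addn0.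
have -> : Ordinal (modn (Ordinal ijP)) = j.
  by apply: val_inj; rewrite /= modnMDl modn_small.
exact: Hx.
Qed.

Lemma FAD_fibering : FAD [set: T'] -> FAD [set: T].
Proof.
(* Dimension is one less than the number of families, hence the predecessor. *)
move=> [m [cm _]]; apply: (@asdim_covers_FAD _ _ _ (m.+1 * n.+1).-1) => r r0.
rewrite prednK ?muln_gt0//.
apply: (@scale_covers_fibering (fun=> r)) => //.
by apply: cm; exact: mulr_gt0.
Qed.

(** Since [n] is the same for all radii, the scales for the base can be fixed before its cover, and
    hence the radius of the fibres, is known. *)
Lemma APC_fibering : APC [set: T'] -> APC [set: T].
Proof.
move=> aT' r r0 rmon.
have [||m cm] := aT' (fun i => L * r (i * n.+1 + n)%N).
- by move=> i; exact: mulr_gt0.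
- by move=> i j ij; rewrite ler_pM2l// rmon// leq_add2r leq_mul2r ij orbT.
by exists (m * n.+1)%N; exact: scale_covers_fibering.
Qed.

End Fixed_dimension.
End Fibering.

(** * Orbit maps of coarse quasi-actions *)

Section OrbitMap.
Context {R : realType} {G : groupType} {X : metricType R}.
Variables (S : set G) (finS : finite_set S) (genS : generates S).
Variables (f : G -> X -> X) (actf : coarse_quasi_action f) (x0 : X).
Local Notation T := (word_metric R genS).

Definition orbit_map (g : T) : X := f g x0.

Lemma finite_set_bounded (h : G -> R) :
  exists M, 0 <= M /\ forall s, S s -> h s <= M.
Proof.
have /finite_seqP[l ->] := finS.
elim: l => [|s l [M [M0 Ml]]]; first by exists 0; split.
exists (Num.max (h s) M); split=> [|t /=]; first by rewrite le_max M0 orbT.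
rewrite inE => /orP[/eqP->|tl]; first by rewrite le_max lexx.
by rewrite le_max (Ml t)// orbT.
Qed.

Lemma orbit_map_lipschitz : exists2 L : R, 0 < L & lipschitz_by L orbit_map.
Proof.
have [[ell [[ell0 _] fell]] _ [B B0 fB]] := actf.
have [M [M0 SM]] :=
  finite_set_bounded (fun s => Num.max (mdist (f s x0) x0)
                                       (mdist (f (s^-1)%g x0) x0)).
(* [M] bounds how far generators and their inverses move [x0]; [ell M] bounds this after applying
   [f g], and [B] pays for replacing [f g (f s x0)] by [f (g * s) x0]. *)
pose L := B + ell M; have L0 : 0 < L by rewrite ltr_wpDl// ell0.
have step g s : S s \/ S (s^-1)%g -> mdist (f g x0) (f (g * s)%g x0) <= L.
  move=> Ss; have sM : mdist (f s x0) x0 <= M.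
    case: Ss => /SM; rewrite ge_max => /andP[]//.
    by rewrite invgK.
  rewrite (le_trans (metric_triangle _ (f g (f s x0)) _))// addrC lerD//.
  by rewrite metric_sym fell.
exists L => // g h; rewrite mdist_word /word_dist.
have [w [Sw <- wgh]] := word_lengthP genS ((g : G)^-1 * (h : G))%g.
have -> : h = ((g : G) * \prod_(s <- w) s)%g :> G by rewrite wgh mulVKg.
(* The starting point is generalized, since the induction walks along the word from [g]. *)
rewrite /orbit_map; move: (g : G) => {}g {wgh}.
elim: w g Sw => [|s w IH] g Sw.
  by rewrite big_nil mulg1 mdistxx mulr0.
rewrite big_cons mulgA (le_trans (metric_triangle _ (f (g * s)%g x0) _))//.
rewrite -[X in _ <= X]/(L * (size w).+1%:R) -natr1 mulrDr mulr1 addrC lerD//.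
  by apply: IH => t tw; apply: Sw; rewrite inE tw orbT.
by apply: step; apply: Sw; rewrite inE eqxx.
Qed.

Lemma translation_isometric (g : G) :
  @isometric_maps R T (fun h : T => (g * (h : G))%g : T).
Proof.
move=> h k; rewrite !mdist_word /word_dist; congr (_%:R); congr word_length.
by rewrite invgM -mulgA mulKg.
Qed.

Lemma orbit_map_fibres (D : R) : exists2 r, 0 <= r &
  forall A : set X, (forall x y, A x -> A y -> mdist x y <= D) ->
  exists2 tau, isometric_maps tau &
    orbit_map @^-1` A `<=` tau @^-1` (quasi_stabilizer f x0 r : set T).
Proof.
have [[ell [[ell0 ellm] fell]] [C C0 fC] [B B0 fB]] := actf.
(* With [k] the inverse of [g0], the path from [f (k * g) x0] through [f k (f g x0)],
   [f k (f g0 x0)] and [f 1 x0] to [x0] costs [B], [ell], [B] and [C]. The maximum keeps the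
   argument of [ell] nonnegative. *)
have D0 : 0 <= Num.max D 0 by rewrite le_max lexx orbT.
exists (B + (ell (Num.max D 0) + (B + C))).
  by rewrite !addr_ge0// ltW// ell0.
move=> A AD; have [[g0 Ag0]|nA] := pselect (exists g, A (orbit_map g)).
  exists (fun h : T => ((g0 : G)^-1 * (h : G))%g : T).
    exact: translation_isometric.
  move=> g Ag; rewrite /quasi_stabilizer /=; set k := ((g0 : G)^-1)%g.
  apply: le_trans (metric_triangle _ (f k (f g x0)) _) _; apply: lerD.
    by rewrite metric_sym.
  apply: le_trans (metric_triangle _ (f k (f g0 x0)) _) _; apply: lerD.
    by apply: fell => //; rewrite le_max (AD _ _ Ag Ag0).
  apply: le_trans (metric_triangle _ (f (k * (g0 : G))%g x0) _) _.
  by apply: lerD => //; rewrite /k mulVg.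
(* If the orbit misses [A], the preimage is empty and any isometry works. *)
by exists id => // g Ag; case: nA; exists g.
Qed.

End OrbitMap.

Theorem mainTheorem1 (R : realType) (G : groupType) (S : set G)
    (finS : finite_set S) (genS : generates S)
    (X : metricType R) (properX : proper_metric_space X)
    (f : G -> X -> X) (actf : coarse_quasi_action f) (x0 : X) :
  ((exists n : nat, forall r : R, 0 <= r ->
      asdim_le (quasi_stabilizer f x0 r : set (word_metric R genS)) n) ->
    (FAD [set: X] -> FAD [set: word_metric R genS]) /\
    (APC [set: X] -> APC [set: word_metric R genS])) /\
  ((FDC [set: X] ->
    (forall r : R, 0 <= r ->
      FDC (quasi_stabilizer f x0 r : set (word_metric R genS))) ->
    FDC [set: word_metric R genS]) /\
   (sFDC [set: X] ->
    (forall r : R, 0 <= r ->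
      sFDC (quasi_stabilizer f x0 r : set (word_metric R genS))) ->
    sFDC [set: word_metric R genS])).

Proof.
have [L L0 piL] := orbit_map_lipschitz finS genS actf x0.
have fib := orbit_map_fibres genS actf x0.
split; last by split; [exact: FDC_fibering L0 piL fib|
                       exact: sFDC_fibering L0 piL fib].
move=> [n dimW].
have {}dimW r : 0 <= r ->
    asdim_covers (quasi_stabilizer f x0 r : set (word_metric R genS)) n.
  by move=> /dimW[m [cm _] mn]; exact: asdim_covers_le cm.
by split; [exact: FAD_fibering L0 piL fib _ dimW|
           exact: APC_fibering L0 piL fib _ dimW].
Qed.
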